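(* Let $X$ be a nonempty finite set, let $\rho:X\times 2^X\to[0,1]$ be a choice rule (so $\sum_{x\in X}\rho(x,F)=1$ for every $F\subseteq X$), and let $\mu^1$ and $\mu^2$ be two FRUM representations of $\rho$. Then for every $F\subseteq X$, every $b\in X\setminus F$ and $i=1,2$: 1) $y_\rho(b,F)=\mu^i\big(\{c\in\mathcal{C}_{\mathrm{FUM}}:\ c(F)=b\ \text{ and }\ c(\{x\})=x\ \text{ for all } x\in X\setminus F\}\big)$; 2) $q_\rho(b,F\cup\{b\})=\mu^i\big(\{c\in\mathcal{C}_{\mathrm{FUM}}:\ c(F\cup\{b\})=b\ \text{ and }\ c(\{x,b\})=x\ \text{ for all } x\in X\setminus F\}\big)$.
   Context: $X$ is a finite set of alternatives; a subset $F\subseteq X$ (possibly empty) is called a frame. Note that $\rho(x,F)$ may be positive for $x\notin F$. Block–Marschak polynomials: for $a\in F$, $q_\rho(a,F)=\sum_{B:\,F\subseteq B\subseteq X}(-1)^{|B\setminus F|}\rho(a,B)$. Auxiliary Block–Marschak polynomials: for $a\notin F$, $y_\rho(a,F)=\sum_{B:\,F\subseteq B\subseteq X,\ a\notin B}(-1)^{|B\setminus F|}\rho(a,B)$. For functions $u,v:X\to\mathbb{R}$ with $v(x)\ge 0$ for all $x$, and $F\subseteq X$, let $U_F(y)=u(y)+v(y)$ if $y\in F$ and $U_F(y)=u(y)$ if $y\notin F$. It is assumed that $U_F$ is injective on $X$ for every $F\subseteq X$. Put $c_{(u,v)}(F)=\operatorname{argmax}_{x\in X}U_F(x)$. Let $\mathcal{C}_{\mathrm{FUM}}$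 be the (finite) set of all functions $c:2^X\to X$ of the form $c=c_{(u,v)}$ for some such $(u,v)$. A FRUM representation of $\rho$ is a probability distribution $\mu$ on $\mathcal{C}_{\mathrm{FUM}}$ such that $\rho(x,F)=\mu(\{c\in\mathcal{C}_{\mathrm{FUM}}: c(F)=x\})$ for every $x\in X$ and every $F\subseteq X$. *)

(* Defs.v *)
From HB Require Import structures.
From mathcomp Require Import all_boot all_order all_algebra.
From mathcomp Require Import boolp reals.

Set Implicit Arguments.
Unset Strict Implicit.
Unset Printing Implicit Defensive.

Import Order.TTheory GRing.Theory Num.Theory.

Local Open Scope ring_scope.

Section ChoiceRules.
Variables (R : realType) (X : finType).
Implicit Types (rho : X -> {set X} -> R) (a x y : X) (F B : {set X}).

(* [rho x F] is the probability of choosing [x] under the frame [F]; it is not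
   required to vanish for [x \notin F]. *)
Definition choice_rule rho : Prop :=
  (forall x F, 0 <= rho x F <= 1) /\ (forall F, \sum_x rho x F = 1).

(* Block-Marschak polynomial, meant for [a \in F]. *)
Definition BM_q rho a F : R :=
  \sum_(B : {set X} | F \subset B) (-1) ^+ #|B :\: F| * rho a B.

(* Auxiliary Block-Marschak polynomial, meant for [a \notin F]. *)
Definition BM_y rho a F : R :=
  \sum_(B : {set X} | (F \subset B) && (a \notin B))
     (-1) ^+ #|B :\: F| * rho a B.

Definition framed_utility (u v : X -> R) F y : R :=
  if y \in F then u y + v y else u y.

Definition admissible (u v : X -> R) : Prop :=
  (forall x, 0 <= v x) /\ (forall F, injective (framed_utility u v F)).

Definition argmax_set (f : X -> R) : {set X} :=
  [set x | [forall y, f y <= f x]].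

(* [c] is the choice function of [(u, v)]; for an admissible pair the argmax is
   a singleton, which is identified with its element. *)
Definition is_choice_of (u v : X -> R) (c : {ffun {set X} -> X}) : Prop :=
  forall F, argmax_set (framed_utility u v F) = [set c F].

Definition C_FUM : {set {ffun {set X} -> X}} :=
  [set c | `[< exists u v : X -> R, admissible u v /\ is_choice_of u v c >]].

Definition FUM : predArgType := {c : {ffun {set X} -> X} | c \in C_FUM}.

HB.instance Definition _ := Finite.on FUM.

Definition FUM_fun (c : FUM) : {set X} -> X := fun F => val c F.

Definition distribution (mu : FUM -> R) : Prop :=
  (forall c, 0 <= mu c) /\ \sum_c mu c = 1.

Definition prob (mu : FUM -> R) (A : {set FUM}) : R := \sum_(c in A) mu c.

Definition FRUM_representation rho (mu : FUM -> R) : Prop :=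
  distribution mu /\
  forall x F, rho x F = prob mu [set c | FUM_fun c F == x].

End ChoiceRules.

Coercion FUM_fun : FUM >-> Funclass.

(* Main.v *)
(** Fix [b \notin F], and let [E] be [set0] for [y] and [[set b]] for [q]. The
    utility of [b] is the same under all frames [B] with [B :&: [set b] = E], so
    a framed utility maximizer chooses [b] under [B] iff it does so under [E] and
    every other element of [B] belongs to the set [T] of those [y <> b] which
    lose against [b] under [y |: E]. Hence the alternating sum over [B] that
    defines the polynomial becomes, for each choice function, an alternating sum
    over the interval [F :|: E, T :|: E] of subsets, which is [1] if [F = T] and
    [0] otherwise; and [F = T] is the event on the right-hand side. *)
Require Import Defs.
From HB Require Import structures.
From mathcomp Require Import all_boot all_order all_algebra.
From mathcomp Require Import boolp reals.

Import Order.TTheory GRing.Theory Num.Theory.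

Local Open Scope ring_scope.

(** If [F] is a proper subset of [T], adding or removing a fixed [t] in [T :\: F] pairs the sets of
    the interval with opposite signs. *)
Lemma sum_sign_interval (R : pzRingType) (X : finType) (F T : {set X}) :
  \sum_(B : {set X} | (F \subset B) && (B \subset T)) (-1) ^+ #|B :\: F|
    = (F == T)%:R :> R.
Proof.
have [<-|neFT] := eqVneq F T.
  rewrite (big_pred1 F) ?setDv ?cards0 // => B.
  by rewrite /= eq_sym eqEsubset.
have [sFT|nsFT] := boolP (F \subset T); last first.
  by rewrite big_pred0 // => B; apply: contraNF nsFT => /andP[]; apply: subset_trans.
have /properP[_ [t tT tF]] : F \proper T by rewrite properEneq neFT.
rewrite (bigID (fun B : {set X} => t \in B)) /=.
rewrite (reindex_onto (fun B => t |: B) (fun B => B :\ t)) /=; last first.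
  by move=> B /andP[_ tB]; rewrite setD1K.
rewrite (eq_bigl (fun B : {set X} =>
    [&& F \subset B, B \subset T & t \notin B])) => [|B]; last first.
  rewrite setU11 andbT subUset sub1set tT /=.
  have [tB|tB] := boolP (t \in B).
    rewrite !andbF; apply/negP => /andP[_ /eqP/setP/(_ t)].
    by rewrite !inE tB eqxx.
  by rewrite setU1K // eqxx !andbT -subDset (setDidPl _) // disjoint_sym disjoints1.
under [X in _ + X = _]eq_bigl do rewrite -andbA.
rewrite -big_split big1 //= => B /and3P[_ _ tB].
have -> : (t |: B) :\: F = t |: (B :\: F).
  by apply/setP => x; rewrite !inE; case: eqVneq => // ->; rewrite tF.
by rewrite cardsU1 !inE (negPf tB) andbF exprS mulN1r addNr.
Qed.

Section FramedUtilityMaximizers.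
Set Implicit Arguments.
Unset Strict Implicit.
Context {R : realType} {X : finType}.
Implicit Types (u v : X -> R) (c : FUM R X) (b x y : X) (B C E F : {set X}).

Lemma eq_framed_utility u v B C x :
  (x \in B) = (x \in C) -> framed_utility u v B x = framed_utility u v C x.
Proof. by rewrite /framed_utility => ->. Qed.

Lemma le_framed_utility u v B C x : (forall z, 0 <= v z) ->
  B \subset C -> framed_utility u v B x <= framed_utility u v C x.
Proof.
move=> v_ge0 /subsetP sBC; rewrite /framed_utility.
case: (boolP (x \in B)) => [/sBC -> //|_].
by case: ifP; rewrite ?lerDl.
Qed.

Lemma FUM_choiceP c : exists u v, (forall x, 0 <= v x) /\ forall B x,
  c B == x <-> forall y, framed_utility u v B y <= framed_utility u v B x.
Proof.
have := valP c; rewrite inE => /asboolP[u [v [[v_ge0 _] cE]]].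
exists u, v; split=> // B x; have /setP/(_ x) := cE B.
by rewrite !inE eq_sym => <-; split=> /forallP.
Qed.

Definition losers c b E : {set X} := [set y | (y != b) && (c (y |: E) == b)].

(** Shrinking [B] to [E] or to [y |: E] keeps the utility of [b] and raises no other, since [v] is
    nonnegative; so [b] still wins. Conversely, a rival [y] has the same utility under [B] as under
    [y |: E] if it lies in [B], and as under [E] if not. *)
Lemma FUM_choice_losers c b B E : B :&: [set b] = E ->
  (c B == b) = (c E == b) && (B :\ b \subset losers c b E).
Proof.
move=> defE; have [u [v [v_ge0 cP]]] := FUM_choiceP c.
have sEB : E \subset B by rewrite -defE subsetIl.
have UbE C : (b \in C) = (b \in B) ->
    framed_utility u v C b = framed_utility u v B b.
  by move=> bC; apply: eq_framed_utility.
have bE : (b \in E) = (b \in B) by rewrite -defE !inE eqxx andbT.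
have byE y : y != b -> (b \in y |: E) = (b \in B).
  by move=> yb; rewrite in_setU1 eq_sym (negPf yb).
apply/idP/andP => [/cP bmax|[/cP bmax /subsetP sBT]].
  split.
    by apply/cP => y; rewrite UbE // (le_trans _ (bmax y)) // le_framed_utility.
  apply/subsetP => y; rewrite !inE => /andP[yb yB]; rewrite yb /=.
  apply/cP => z; rewrite [leRHS]UbE ?byE // (le_trans _ (bmax z)) //.
  by rewrite le_framed_utility // subUset sub1set yB.
apply/cP => y; have [->//|yb] := eqVneq y b.
have [yB|yB] := boolP (y \in B).
  have := sBT y; rewrite !inE yb yB => /(_ isT)/cP/(_ y).
  by rewrite [leRHS]UbE ?byE // (@eq_framed_utility _ _ _ B) // !inE eqxx yB.
have := bmax y; rewrite [leRHS]UbE // (@eq_framed_utility _ _ _ B) //.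
by rewrite -defE !inE (negPf yB).
Qed.

(** Adding [x] to the frame can raise only the utility of [x]: a winner other than [x] has the
    utility it had under [E], which does not exceed that of [b]. *)
Lemma FUM_choice_setU1 c b x E :
  c E = b -> c (x |: E) = b \/ c (x |: E) = x.
Proof.
move=> /eqP cEb; have [u [v [v_ge0 cP]]] := FUM_choiceP c.
have [->|zx] := eqVneq (c (x |: E)) x; [by right|left].
apply/eqP/cP => y; have /cP/(_ y)/le_trans := eqxx (c (x |: E)); apply.
rewrite (@eq_framed_utility _ _ _ E); last by rewrite in_setU1 (negPf zx).
move/cP: cEb => /(_ (c (x |: E)))/le_trans; apply.
by rewrite le_framed_utility ?subsetUr.
Qed.

(** Given that [b] wins under [E], its winning under [F :|: E] means that [F] is included in the
    losers; the quantified condition is the reverse inclusion, because under [x |: E] only [b] or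
    [x] can win. *)
Lemma FUM_event_losers c b F E : b \notin F -> E \subset [set b] ->
  (c (F :|: E) == b) && [forall x in ~: F, c (x |: E) == x]
    = (c E == b) && (F == losers c b E).
Proof.
move=> bF sEb.
have defE : (F :|: E) :&: [set b] = E.
  by rewrite setIUl (setIidPl sEb) (disjoint_setI0 _) ?set0U // disjoint_sym disjoints1.
have defF : (F :|: E) :\ b = F.
  rewrite setDUl (eqP (_ : E :\ b == set0)) ?setU0 ?setD_eq0 //.
  by apply/setDidPl; rewrite disjoint_sym disjoints1.
rewrite (FUM_choice_losers _ defE) defF -andbA.
have [cEb /=|//] := eqVneq (c E) b; rewrite eqEsubset; congr andb.
apply/forall_inP/subsetP => [Fwin y|sTF x].
  rewrite !inE => /andP[yb /eqP cyb]; apply: contraTT yb => yF; rewrite negbK.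
  by have := Fwin y; rewrite inE cyb eq_sym => /(_ yF).
rewrite inE => xF; have [cxb|->//] := FUM_choice_setU1 x cEb.
(* For [x = b] the two possible winners coincide; any other [x] losing to [b] would lie in [F]. *)
have [->|xb] := eqVneq x b; first by have [->|->] := FUM_choice_setU1 b cEb.
by rewrite sTF ?inE ?xb ?cxb ?eqxx in xF.
Qed.

(** The condition that [B] and [E] agree on [b] covers both polynomials: it reads [b \notin B] for
    [E = set0], and follows from [F :|: E \subset B] for [E = [set b]]. *)
Lemma sum_sign_FUM_choice c b F E : b \notin F -> E \subset [set b] ->
  \sum_(B : {set X} | (F :|: E \subset B) && ((b \in B) == (b \in E)))
     (-1) ^+ #|B :\: (F :|: E)| * (c B == b)%:R
    = ((c (F :|: E) == b) && [forall x in ~: F, c (x |: E) == x])%:R :> R.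
Proof.
move=> bF sEb; rewrite FUM_event_losers //.
set T := losers c b E; have bT : b \notin T by rewrite inE eqxx.
have xE x : x != b -> x \in E = false.
  by move=> xb; apply: contraNF xb => /(subsetP sEb); rewrite inE.
have -> : (F == T) = (F :|: E == T :|: E).
  apply/eqP/eqP => [->//|/setP eqFT]; apply/setP => x.
  have [->|xb] := eqVneq x b; first by rewrite (negPf bF) (negPf bT).
  by have := eqFT x; rewrite !in_setU xE // !orbF.
have cBE B : (b \in B) == (b \in E) ->
    (c B == b) = (c E == b) && (B \subset T :|: E).
  move=> /eqP bBE; have defE : B :&: [set b] = E.
    apply/setP => x; rewrite !inE.
    by have [->|xb] := eqVneq x b; rewrite ?andbT ?andbF // xE.
  rewrite (FUM_choice_losers _ defE); congr andb.
  apply/subsetP/subsetP => [sBT x xB|sBT x].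
    rewrite in_setU; have [xb|xb] := eqVneq x b; first by rewrite xb -bBE -xb xB orbT.
    by rewrite sBT // !inE xb.
  by rewrite in_setD1 => /andP[xb /sBT]; rewrite in_setU xE // orbF.
rewrite -mulnb natrM -sum_sign_interval mulr_sumr big_mkcond [RHS]big_mkcond.
apply: eq_bigr => B _ /=.
have [bBE|bBE] := boolP ((b \in B) == _).
  rewrite andbT cBE //; case: (F :|: E \subset B) => //=.
  by rewrite -mulnb natrM mulrC mulrAC; case: (B \subset _); rewrite (mulr1, mulr0).
(* A set [B] that disagrees with [E] on [b] is outside the interval from [F :|: E] to [T :|: E], as
   [b] is not in [T]. *)
rewrite andbF; case: ifP => // /andP[/subsetP sFB /subsetP sBT].
case/negP: bBE; apply/eqP; apply/idP/idP => [/sBT|bE]; last by rewrite sFB ?in_setU ?bE ?orbT.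
by rewrite in_setU (negPf bT).
Qed.

Lemma probE (mu : FUM R X -> R) (A : {pred FUM R X}) :
  prob mu [set c | A c] = \sum_c mu c * (A c)%:R.
Proof.
rewrite /prob big_mkcond; apply: eq_bigr => c _; rewrite inE.
by case: (A c); rewrite (mulr1, mulr0).
Qed.

(** By linearity: [rho b B] is the mean under [mu] of the indicator of [c B == b], so exchanging the
    sums leaves the alternating sum of each single [c]. *)
Lemma BM_FRUM rho (mu : FUM R X -> R) b F E :
  FRUM_representation rho mu -> b \notin F -> E \subset [set b] ->
  \sum_(B : {set X} | (F :|: E \subset B) && ((b \in B) == (b \in E)))
     (-1) ^+ #|B :\: (F :|: E)| * rho b B
    = prob mu [set c : FUM R X |
        (c (F :|: E) == b) && [forall x in ~: F, c (x |: E) == x]].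
Proof.
move=> [_ rhoE] bF sEb; rewrite probE.
under [RHS]eq_bigr do rewrite -sum_sign_FUM_choice // mulr_sumr.
rewrite exchange_big; apply: eq_bigr => B _ /=.
rewrite rhoE probE mulr_sumr; apply: eq_bigr => c _; exact: mulrCA.
Qed.

End FramedUtilityMaximizers.

Theorem proposition2 (R : realType) (X : finType) (X_nonempty : (0 < #|X|)%N)
    (rho : X -> {set X} -> R) (rho_rule : choice_rule rho)
    (mu1 mu2 : FUM R X -> R)
    (mu1_rep : FRUM_representation rho mu1)
    (mu2_rep : FRUM_representation rho mu2)
    (F : {set X}) (b : X) (bF : b \in ~: F) (mu : FUM R X -> R)
    (mu_i : mu = mu1 \/ mu = mu2) :
  BM_y rho b F
    = prob mu [set c : FUM R X |
        (c F == b) && [forall x in ~: F, c [set x] == x]]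
  /\
  BM_q rho b (F :|: [set b])
    = prob mu [set c : FUM R X |
        (c (F :|: [set b]) == b) && [forall x in ~: F, c [set x; b] == x]].
Proof.
have mu_rep : FRUM_representation rho mu by case: mu_i => ->.
rewrite inE in bF; split; last first.
  rewrite -(BM_FRUM mu_rep) //; apply: eq_bigl => B.
  by rewrite set11 subUset sub1set -andbA; case: (b \in B).
transitivity (prob mu [set c : FUM R X | (c (F :|: set0) == b)
    && [forall x in ~: F, c (x |: set0) == x]]).
  rewrite -(BM_FRUM mu_rep) ?sub0set // setU0; apply: eq_bigl => B.
  by rewrite in_set0 eqbF_neg.
congr prob; apply/setP => c; rewrite !inE setU0; congr andb.
by apply: eq_forallb => x; rewrite setU0.
Qed.
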